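(* There exists $n_0>0$ such that for all integers $n\ge n_0$ we have $$f(n,2)=2^{\lceil n/2\rceil}.$$ Moreover, the only subsets $A\subseteq[n]$ with $f(A,2)=f(n,2)$ are $O$ and $I_2$, together with, when $n$ is even, the two additional sets $\{n/2,\ldots,n-1\}$ and $\{n/2,\ldots,n\}$.
   Context: For integers $m\le n$ write $[m,n]=\{m,\ldots,n\}$ and $[n]=[1,n]$. A Schur triple (sum) in a set $S\subseteq\mathbb{Z}$ is a triple $\{x,y,z\}\subseteq S$ of not necessarily distinct elements with $x+y=z$. A set is sum-free if it contains no Schur triple. For $A\subseteq[n]$ and a positive integer $r$, a colouring $\sigma:A\to[r]$ is valid if $\sigma^{-1}(c)$ is sum-free for every colour $c\in[r]$. Let $f(A,r)$ denote the number of valid colourings of $A$, and let $f(n,r)=\max_{A\subseteq[n]} f(A,r)$. Let $O=\{1,3,5,\ldots,2\lceil n/2\rceil-1\}$ be the set of odd integers in $[n]$, and $I_2=[\lfloor n/2\rfloor+1,n]$. *)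

(* Defs.v *)
From mathcomp Require Import all_boot finmap.

Set Implicit Arguments.
Unset Strict Implicit.
Unset Printing Implicit Defensive.

Local Open Scope fset_scope.
Local Open Scope nat_scope.

(* Empty when n < m. *)
Definition interval (m n : nat) : {fset nat} := [fset k in iota m (n.+1 - m)].

(* x, y and z need not be distinct. *)
Definition schur_triple (x y z : nat) : bool := x + y == z.

Definition sum_free (S : {fset nat}) : bool :=
  ~~ [exists x : S, [exists y : S, [exists z : S,
        schur_triple (val x) (val y) (val z)]]].

Definition colour_class (A : {fset nat}) (r : nat) (sigma : {ffun A -> 'I_r})
    (c : 'I_r) : {fset nat} :=
  [fset val x | x : A & sigma x == c].

Definition valid_colouring (A : {fset nat}) (r : nat)
    (sigma : {ffun A -> 'I_r}) : bool :=
  [forall c : 'I_r, sum_free (colour_class sigma c)].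

Definition num_valid (A : {fset nat}) (r : nat) : nat :=
  #|[set sigma : {ffun A -> 'I_r} | valid_colouring sigma]|.

Definition max_num_valid (n r : nat) : nat :=
  \max_(A <- fpowerset (interval 1 n)) num_valid A r.

Definition odd_set (n : nat) : {fset nat} := [fset k in interval 1 n | odd k].

Definition I2 (n : nat) : {fset nat} := interval (n./2).+1 n.

(* Main.v *)
Require Import Defs.
From mathcomp Require Import all_boot finmap zify.

Set Implicit Arguments.
Unset Strict Implicit.
Unset Printing Implicit Defensive.

Local Open Scope fset_scope.
Local Open Scope nat_scope.

(** Deleting the top element [N] of [A] gives [f(A) <= f(A \ N) + F], where [F]
    counts the valid colourings of [A \ N] in which [N] may still take both colours,
    i.e. those giving distinct colours to [x] and [N - x]. There are
    [(N - 1)/2] such pairs, so for odd [N] this alone yields the bound by induction.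
    If [F >= 2^((N-1)/2) / 4], then only boundedly many disjoint Schur triples can
    be monochromatic in some such colouring, because each of them costs a factor
    3/4. So either no pair [x, N - x] lies in [A], and [A] is a sum-free set
    of maximum size, or the elements of [A] below [N/2] are close to [N/2].
    In the second case pairing [l] with [2l] gives [f(A) <= 2^ceil(N/2)]
    with equality only for [I2].
    For even [n] two top elements are removed at once, and the loss outside the
    extremal cases absorbs the additive constant inherited from small [n]. *)

(** * Finite sets and intervals *)

Lemma leq_card_image (T T' : choiceType) (f : T -> T') (S : {fset T}) :
  #|` f @` S| <= #|` S|.
Proof. exact: leq_imfset_card. Qed.

Lemma card_image_in (T T' : choiceType) (f : T -> T') (S : {fset T}) :
  {in S &, injective f} -> #|` f @` S| = #|` S|.
Proof. by move=> inj; rewrite card_in_imfset. Qed.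

Lemma leq_cardU (T : choiceType) (S S' : {fset T}) :
  #|` S `|` S'| <= #|` S| + #|` S'|.
Proof. by case: (leq_card_fsetU S S'). Qed.

Lemma mem_sep (T : choiceType) (A : {fset T}) (P : pred T) x :
  (x \in [fset y in A | P y]) = (x \in A) && P x.
Proof. by rewrite in_fset inE. Qed.

Lemma notin_fsub (T : choiceType) (R A : {fset T}) x :
  R `<=` A -> x \notin A -> (x \in R) = false.
Proof. by move=> /fsubsetP RA; apply/contraNF/RA. Qed.

Lemma mem_interval m n k : (k \in interval m n) = (m <= k <= n).
Proof. by rewrite /interval in_fset /= mem_iota; lia. Qed.

(** * Valid 2-colourings as sets of red elements *)

Lemma sum_freeP (S : {fset nat}) :
  reflect (forall x y, x \in S -> y \in S -> x + y \notin S) (sum_free S).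
Proof.
apply: (iffP idP) => [/existsPn H x y xS yS|H].
  apply/negP => zS; have /existsPn /(_ [` yS]) /existsPn /(_ [` zS]) := H [` xS].
  by rewrite /schur_triple eqxx.
apply/existsPn => x; apply/existsPn => y; apply/existsPn => z.
rewrite /schur_triple; apply: contra (H _ _ (valP x) (valP y)) => /eqP ->.
exact: valP.
Qed.

(* A valid 2-colouring is encoded by its set [R] of elements of colour 0. *)
Definition reds (A : {fset nat}) : {fset {fset nat}} :=
  [fset R in fpowerset A | sum_free R && sum_free (A `\` R)].

Definition monochromatic (R : {fset nat}) (x y z : nat) : bool :=
  ((x \in R) == (z \in R)) && ((y \in R) == (z \in R)).

Lemma redsP (A R : {fset nat}) :
  reflect (R `<=` A /\ forall x y, x \in A -> y \in A -> x + y \in A ->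
             ~~ monochromatic R x y (x + y))
    (R \in reds A).
Proof.
rewrite !inE /= fpowersetE.
apply: (iffP and3P) => [[RA /sum_freeP sR /sum_freeP sB]|[RA H]]; split=> //.
- move=> x y xA yA zA; rewrite /monochromatic; apply/negP => /andP [/eqP ex /eqP ey].
  case zR: (x + y \in R) ex ey => xR yR; first by move: (sR x y xR yR); rewrite zR.
  by have := sB x y; rewrite !inE xA yA zA xR yR zR => /(_ isT isT).
- apply/sum_freeP => x y xR yR; apply/negP => zR.
  have := H x y (fsubsetP RA _ xR) (fsubsetP RA _ yR) (fsubsetP RA _ zR).
  by rewrite /monochromatic xR yR zR.
- apply/sum_freeP => x y; rewrite !inE => /andP [xR xA] /andP [yR yA].
  apply/negP => /andP [zR zA]; have := H x y xA yA zA.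
  by rewrite /monochromatic (negbTE xR) (negbTE yR) (negbTE zR).
Qed.

(** The class of colour 0 determines a 2-colouring, since the other class is its complement in
    [A]. *)
Lemma num_validE (A : {fset nat}) : num_valid A 2 = #|` reds A|.
Proof.
pose red (s : {ffun A -> 'I_2}) := colour_class s ord0.
have memc (s : {ffun A -> 'I_2}) c (x : nat) (xA : x \in A) :
    (x \in colour_class s c) = (s [` xA] == c).
  apply/imfsetP/idP => [[y /= sy xE]|sx]; last by exists [` xA].
  have -> : [` xA] = y by apply: val_inj.
  by move: sy; rewrite inE.
have subc (s : {ffun A -> 'I_2}) c : colour_class s c `<=` A.
  by apply/fsubsetP => x /imfsetP [y _ ->]; exact: fsvalP.
have blueE (s : {ffun A -> 'I_2}) : colour_class s ord_max = A `\` red s.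
  apply/fsetP => x; rewrite inE.
  case: (boolP (x \in A)) => [xA|xA].
    rewrite /red !memc andbT; case: (s [` xA]) => [[|[|]]] //.
  by rewrite andbF; apply/negbTE; apply: contra xA; apply/fsubsetP/subc.
have validE s : valid_colouring s = (red s \in reds A).
  rewrite !inE /= fpowersetE subc /= -blueE.
  apply/forallP/andP => [H|[H0 H1] [[|[|]] i] //]; first by split; apply: H.
rewrite /num_valid -[LHS]card_finset.
have injr : {in [fset s in [set s : {ffun A -> 'I_2} | valid_colouring s]] &, injective red}.
  move=> s t _ _ st; apply/ffunP => -[x xA].
  have := memc s ord0 x xA; have := memc t ord0 x xA.
  rewrite -[colour_class s _]/(red s) st => ->.
  by case: (s _) (t _) => [[|[|]] i] // [[|[|]] j] // _; apply: val_inj.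
rewrite -(card_image_in injr); congr #|` _|; apply/fsetP => R.
apply/imfsetP/idP => [[s /=]|RA]; first by move=> + ->; rewrite -validE !inE.
have sRA : R `<=` A by case/redsP: RA.
pose s := [ffun x : A => if val x \in R then ord0 else ord_max : 'I_2].
have Rs : R = red s.
  apply/fsetP => x; case: (boolP (x \in A)) => [xA|xA].
    by rewrite memc ffunE /=; case: ifP.
  by rewrite (notin_fsub sRA xA) (notin_fsub (subc s ord0) xA).
by exists s; rewrite //= in_fset inE validE -Rs.
Qed.

(** * Colourings alternating on classes, and the factor 3/4 per Schur triple *)

(** The fibres of [cl] record which elements are forced apart: the identity imposes nothing,
    [pair_min N] separates [x] from [N - x], and [double_low N] separates [l] from [2l]. *)
Definition alternating (cl : nat -> nat) (A R : {fset nat}) : bool :=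
  all (fun x => all (fun y => (x != y) && (cl x == cl y) ==>
                        ((x \in R) != (y \in R))) A) A.

Lemma alternatingP cl (A R : {fset nat}) :
  reflect (forall x y, x \in A -> y \in A -> x != y -> cl x = cl y ->
             (x \in R) != (y \in R))
    (alternating cl A R).
Proof.
apply: (iffP allP) => [H x y xA yA xy cxy|H x xA].
  by have /allP /(_ y yA) := H x xA; rewrite xy cxy eqxx.
by apply/allP => y yA; apply/implyP => /andP [xy /eqP cxy]; apply: H.
Qed.

(** The colour of one representative fixes the colours of its whole class. *)
Lemma card_alternating cl (A : {fset nat}) :
  #|` [fset R in fpowerset A | alternating cl A R]| <= 2 ^ #|` cl @` A|.
Proof.
(* The default 0 is never reached, as only classes that meet [A] are looked up. *)
pose rep k := head 0 [seq x <- A | cl x == k].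
have repP x : x \in A -> rep (cl x) \in A /\ cl (rep (cl x)) = cl x.
  move=> xA; rewrite /rep.
  have : x \in [seq y <- A | cl y == cl x] by rewrite mem_filter eqxx xA.
  case E: [seq y <- A | cl y == cl x] => [|y s] //= _.
  have : y \in [seq y <- A | cl y == cl x] by rewrite E mem_head.
  by rewrite mem_filter => /andP [/eqP ? ?].
pose phi (R : {fset nat}) := [fset k in cl @` A | rep k \in R].
rewrite -card_fpowerset.
have injphi : {in [fset R in fpowerset A | alternating cl A R] &, injective phi}.
  move=> R R'; rewrite !inE /= !fpowersetE.
  move=> /andP [RA /alternatingP aR] /andP [RA' /alternatingP aR'] E.
  apply/fsetP => x; case: (boolP (x \in A)) => [xA|xA]; last first.
    by rewrite (notin_fsub RA xA) (contraNF (fsubsetP RA' x) xA).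
  have [rA rE] := repP x xA.
  have : rep (cl x) \in R = (rep (cl x) \in R').
    have := congr1 (fun S : {fset nat} => cl x \in S) E.
    by rewrite !inE /= in_imfset.
  have [->//|nx] := eqVneq (rep (cl x)) x.
  have := aR _ _ rA xA nx rE; have := aR' _ _ rA xA nx rE.
  by move=> + + E'; rewrite E'; do ![case: (_ \in _)].
rewrite -(card_image_in injphi); apply: fsubset_leq_card.
apply/fsubsetP => S /imfsetP [R _ ->]; rewrite fpowersetE.
by apply/fsubsetP => k; rewrite !inE /= => /andP [].
Qed.

(* Swaps the colours on the classes [k] (if [b]) and [l] (if [c]); alternation survives. *)
Definition flip (cl : nat -> nat) (A : {fset nat}) (k l : nat) (b c : bool)
    (R : {fset nat}) : {fset nat} :=
  [fset y in A | (y \in R) (+) (b && (cl y == k)) (+) (c && (cl y == l))].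

(** The centre [c] may be a summand (for shifts) or the sum (for reflections). *)
Definition schur3 (c : nat) (t : nat * nat) : bool :=
  [|| c + t.1 == t.2, c + t.2 == t.1 | t.1 + t.2 == c].

Definition not_monochromatic (R : {fset nat}) (c : nat) (t : nat * nat) : bool :=
  ~~ (((t.1 \in R) == (c \in R)) && ((t.2 \in R) == (c \in R))).

Definition ends (ts : seq (nat * nat)) : seq nat :=
  flatten [seq [:: t.1; t.2] | t <- ts].

(* For fixed colour of [c], one of the four combined flips of the classes of [u] and
   [v] makes [(c, u, v)] monochromatic, so each triple keeps at most 3/4 of the rest. *)
Lemma card_not_monochromatic cl (A : {fset nat}) c (ts : seq (nat * nat)) :
  c \in A -> {subset ends ts <= A} -> uniq [seq cl x | x <- c :: ends ts] ->
  4 ^ size ts * #|` [fset R in fpowerset A | alternating cl A R &&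
                                all (not_monochromatic R c) ts]|
    <= 3 ^ size ts * 2 ^ #|` cl @` A|.
Proof.
move=> cA; elim: ts => [|[u v] ts IH] /=.
  move=> _ _; rewrite !mul1n.
  apply: leq_trans (card_alternating cl A); apply: fsubset_leq_card.
  by apply/fsubsetP => R; rewrite !inE /= => /and3P [-> ->].
move=> sub; rewrite !inE !negb_or => /andP[/and3P[cu cv cts] /andP[/andP[uv uts] /andP[vts unq]]].
have uA : u \in A by apply: sub; rewrite inE eqxx.
have vA : v \in A by apply: sub; rewrite !inE eqxx orbT.
have subts : {subset ends ts <= A}.
  by move=> x xs; apply: sub; rewrite !inE xs !orbT.
have {}IH : 4 ^ size ts * #|` [fset R in fpowerset A | alternating cl A R && all (not_monochromatic R c) ts]|
   <= 3 ^ size ts * 2 ^ #|` cl @` A| by apply: IH => //=; rewrite cts.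
set P := [fset R in _ | _] in IH.
set Q := [fset R in _ | _].
suff PQ : 4 * #|` Q| <= 3 * #|` P|.
  rewrite !expnS -(mulnA 3); apply: leq_trans (leq_mul (leqnn 3) IH).
  by rewrite (mulnC 4) -mulnA (mulnCA 3) leq_mul2l PQ orbT.
pose fl b e := flip cl A (cl u) (cl v) b e.
have flP b e R : R \in P -> fl b e R \in P.
  rewrite !inE /= !fpowersetE => /and3P [RA aR uR]; apply/and3P; split.
  - by apply/fsubsetP => y; rewrite !inE /= => /andP[].
  - apply/alternatingP => x y xA yA xy cxy.
    have := alternatingP _ _ _ aR x y xA yA xy cxy.
    rewrite !inE /= xA yA cxy /=.
    by case: (x \in R); case: (y \in R); case: (b && _); case: (e && _).
  (* Colours change only on the classes of [u] and [v], which contain neither [c] nor a member of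
     the other triples. *)
  - have cR x : x \in A -> cl x != cl u -> cl x != cl v -> (x \in fl b e R) = (x \in R).
      by move=> xA xu xv; rewrite !inE /= xA (negbTE xu) (negbTE xv) !andbF !addbF.
    apply/allP => t tts; move/allP/(_ t tts): uR; rewrite /not_monochromatic.
    have [t1 t2] : t.1 \in ends ts /\ t.2 \in ends ts.
      by split; apply/flattenP; exists [:: t.1; t.2]; rewrite ?inE ?eqxx ?orbT //;
         apply/mapP; exists t.
    have ne x y : x \in ends ts -> cl y \notin [seq cl i | i <- ends ts] -> cl x != cl y.
      by move=> xe; apply: contraNneq => <-; apply: map_f.
    by rewrite (cR c cA cu cv) !cR ?ne ?subts.
have flK b e R : R `<=` A -> fl b e (fl b e R) = R.
  move=> RA; apply/fsetP => y; rewrite !inE /=.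
  case: (boolP (y \in A)) => [yA|yA] /=.
    by case: (y \in R); case: (b && _); case: (e && _).
  by rewrite (notin_fsub RA yA).
have QP : Q `<=` P.
  by apply/fsubsetP => R; rewrite !inE /= => /and3P [-> -> /andP[_ ->]].
pose B := P `\` Q.
(* Flipping the classes of those among [u] and [v] that disagree with [c] makes the triple
   monochromatic and carries [R] into [B]. Flips are involutions, so four images of [B] cover
   [P]. *)
have cover : P `<=` B `|` fl false true @` B `|` (fl true false @` B `|` fl true true @` B).
  apply/fsubsetP => R RP.
  have RA : R `<=` A by move: RP; rewrite !inE /= fpowersetE => /and3P[].
  pose b := (u \in R) (+) (c \in R); pose e := (v \in R) (+) (c \in R).
  have inB : fl b e R \in B.
    rewrite inE (flP b e R RP) andbT !inE /= !negb_and; apply/orP; right; apply/orP; right.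
    apply/orP; left; rewrite negbK !inE /= uA vA cA !eqxx /= (negbTE uv) (negbTE cu) (negbTE cv).
    rewrite (eq_sym (cl v)) (negbTE uv) !andbF !andbT !addbF /b /e.
    by do ![case: (_ \in _)].
  have RE : R = fl b e (fl b e R) by rewrite flK.
  have fl0 : fl false false R = R.
    apply/fsetP => y; rewrite !inE /= !addbF andb_idl //; exact/fsubsetP.
  rewrite !in_fsetU; move: inB RE; case: b; case: e => inB RE.
  - by rewrite {4}RE (in_imfset _ (fl true true)) ?orbT.
  - by rewrite {3}RE (in_imfset _ (fl true false)) ?orbT.
  - by rewrite {2}RE (in_imfset _ (fl false true)) ?orbT.
  - by rewrite fl0 in inB; rewrite inB.
have cB : #|` P| <= 4 * #|` B|.
  have im b e : #|` fl b e @` B| <= #|` B| by apply: leq_card_image.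
  apply: leq_trans (fsubset_leq_card cover) _; apply: leq_trans (leq_cardU _ _) _.
  rewrite (_ : 4 * #|` B| = (#|` B| + #|` B|) + (#|` B| + #|` B|)); last by rewrite !mulSn mul0n addn0 !addnA.
  by rewrite leq_add // (leq_trans (leq_cardU _ _)) // leq_add.
move: cB; rewrite /B cardfsDS //; move: (fsubset_leq_card QP).
by move: #|` P| #|` Q| => p q; clear; lia.
Qed.

Lemma card_reds_star cl (A : {fset nat}) (S : {fset {fset nat}}) c (ts : seq (nat * nat)) :
  (forall R, R \in S -> R \in reds A /\ alternating cl A R) ->
  c \in A -> {subset ends ts <= A} -> uniq [seq cl x | x <- c :: ends ts] ->
  all (schur3 c) ts ->
  4 ^ size ts * #|` S| <= 3 ^ size ts * 2 ^ #|` cl @` A|.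
Proof.
move=> HS cA sub unq /allP sch; apply: leq_trans (card_not_monochromatic cA sub unq).
rewrite leq_mul2l; apply/orP; right; apply: fsubset_leq_card.
apply/fsubsetP => R /HS [/redsP [RA H] aR]; rewrite !inE /= fpowersetE RA aR /=.
apply/allP => t tts.
have [t1 t2] : t.1 \in A /\ t.2 \in A.
  by split; apply: sub; apply/flattenP; exists [:: t.1; t.2]; rewrite ?inE ?eqxx ?orbT //;
     apply/mapP; exists t.
rewrite /not_monochromatic; case/or3P: (sch t tts) => /eqP E.
- have := H c t.1 cA t1; rewrite E => /(_ t2); rewrite /monochromatic.
  by do ![case: (_ \in _)].
- have := H c t.2 cA t2; rewrite E => /(_ t1); rewrite /monochromatic.
  by do ![case: (_ \in _)].
- have := H _ _ t1 t2; rewrite E => /(_ cA); rewrite /monochromatic.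
  by do ![case: (_ \in _)].
Qed.

(** * First bounds on the number of valid colourings *)

Lemma card_reds_classes cl (A : {fset nat}) :
  (forall R, R \in reds A -> alternating cl A R) ->
  #|` reds A| <= 2 ^ #|` cl @` A|.
Proof.
move=> alt; apply: leq_trans (card_alternating cl A); apply: fsubset_leq_card.
apply/fsubsetP => R RA; rewrite !inE /= alt // andbT fpowersetE.
by case/redsP: RA.
Qed.

Lemma alternating_id (A R : {fset nat}) : alternating id A R.
Proof. by apply/alternatingP => x y _ _ /eqP xy yx; case: xy. Qed.

Lemma card_reds_le (A : {fset nat}) : #|` reds A| <= 2 ^ #|` A|.
Proof.
have := @card_reds_classes id A (fun R _ => alternating_id A R).
by move/leq_trans; apply; rewrite leq_exp2l // leq_card_image.
Qed.

Lemma card_reds_sum_free (A : {fset nat}) :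
  sum_free A -> #|` reds A| = 2 ^ #|` A|.
Proof.
move=> /sum_freeP sA; rewrite -card_fpowerset; congr #|` _|.
apply/fsetP => R; rewrite fpowersetE; apply/redsP/idP => [[]//|RA]; split=> //.
by move=> x y xA yA zA; move: (sA x y xA yA); rewrite zA.
Qed.

(** A triple [x + x = 2x] forces two colours apart and halves the count. Three distinct members
    exclude 2 of their 8 colourings. *)
Lemma card_reds_not_sum_free (A : {fset nat}) :
  0 \notin A -> ~~ sum_free A -> 4 * #|` reds A| <= 3 * 2 ^ #|` A|.
Proof.
move=> A0 nsA.
have [x [y [xA yA zA]]] : exists x y, [/\ x \in A, y \in A & x + y \in A].
  have : ~~ all (fun x => all (fun y => x + y \notin A) A) A.
    apply: contra nsA => /allP H; apply/sum_freeP => x y xA yA.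
    by have /allP := H x xA; apply.
  by move=> /allPn [x xA /allPn [y yA zA]]; exists x, y; rewrite negbK in zA.
have x0 : x != 0 by apply: contraNneq A0 => <-.
have y0 : y != 0 by apply: contraNneq A0 => <-.
have [xy|xy] := eqVneq x y.
  pose cl k := if k == x + y then x else k.
  have alt R : R \in reds A -> alternating cl A R.
    move=> /redsP [_ /(_ _ _ xA yA zA)]; rewrite /monochromatic -xy => nm.
    apply/alternatingP => a b aA bA ab; rewrite /cl -xy.
    have [aE|_] := eqVneq a (x + x); have [bE|_] := eqVneq b (x + x).
    - by rewrite aE bE eqxx in ab.
    - by move=> <-; rewrite aE; move: nm; do ![case: (_ \in _)].
    - by move=> ->; rewrite bE; move: nm; do ![case: (_ \in _)].
    - by move=> ab'; rewrite ab' eqxx in ab.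
  have := card_reds_classes alt.
  have : cl @` A `<=` A `\ (x + y).
    apply/fsubsetP => _ /imfsetP [a /= aA ->]; rewrite !inE /cl.
    by have [_|aN] := eqVneq a (x + y); rewrite ?xA ?aN ?aA ?andbT //; lia.
  move=> /fsubset_leq_card => le1 le2.
  have := cardfsD1 (x + y) A; rewrite zA => ->; rewrite add1n expnS.
  have := leq_trans le2 (leq_pexp2l (isT : 0 < 2) le1); lia.
have -> : #|` A| = #|` id @` A| by rewrite card_image_in.
rewrite -(expn1 4) -(expn1 3).
apply: (@card_reds_star id A (reds A) x [:: (y, x + y)]) => //.
- by move=> R RA; split=> //; exact: alternating_id.
- by move=> k; rewrite !inE => /orP [] /eqP ->.
- by rewrite /= !inE; lia.
- by rewrite /= /schur3 /= eqxx.
Qed.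

(** * Removing the top element *)

Definition pair_min (N x : nat) : nat := minn x (N - x).

(* Contains every colouring of [A `\ N] that extends to [N] in both colours. *)
Definition pair_reds (A : {fset nat}) (N : nat) : {fset {fset nat}} :=
  [fset R in reds (A `\ N) | alternating (pair_min N) (A `\ N) R].

Lemma in_pair_reds (A : {fset nat}) N R :
  (R \in pair_reds A N) = (R \in reds (A `\ N)) && alternating (pair_min N) (A `\ N) R.
Proof. exact: mem_sep. Qed.

Lemma reds_sub (A B R : {fset nat}) : B `<=` A -> R \in reds A -> R `&` B \in reds B.
Proof.
move=> /fsubsetP BA /redsP [RA H]; apply/redsP; split; first exact: fsubsetIr.
move=> x y xB yB zB; have := H x y (BA _ xB) (BA _ yB) (BA _ zB).
by rewrite /monochromatic !inE xB yB zB !andbT.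
Qed.

(** Colourings with [N] red and those with [N] blue both embed into the colourings of the rest; [J]
    collects the ones hit twice. The case [x = y] is included on purpose: it makes [J] empty when
    [N] is twice an element. *)
Lemma card_redsD1 (A : {fset nat}) N :
  N \in A ->
  exists2 J : {fset {fset nat}}, #|` reds A| <= #|` reds (A `\ N)| + #|` J| &
    forall R, R \in J -> R \in reds (A `\ N) /\
      forall x y, x \in A `\ N -> y \in A `\ N -> x + y = N -> (x \in R) != (y \in R).
Proof.
move=> NA.
pose S1 := [fset R in reds A | N \in R]; pose S0 := [fset R in reds A | N \notin R].
pose J1 := (fun R : {fset nat} => R `\ N) @` S1.
have subR R : R \in reds A -> R `\ N \in reds (A `\ N).
  move=> RA; have <- : R `&` (A `\ N) = R `\ N; last exact: reds_sub (fsubD1set A N) RA.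
  apply/fsetP => x; rewrite !inE; case: (boolP (x \in R)) => [xR|]; rewrite ?andbF //.
  by rewrite (fsubsetP (proj1 (redsP _ _ RA)) x xR) andbT.
have cJ1 : #|` J1| = #|` S1|.
  apply: card_image_in => R R'; rewrite !mem_sep => /andP [_ NR] /andP [_ NR'] E.
  by rewrite -(fsetD1K NR) -(fsetD1K NR') E.
have cA : #|` reds A| <= #|` S1| + #|` S0|.
  apply: leq_trans (leq_cardU _ _); apply: fsubset_leq_card.
  apply/fsubsetP => R RA; rewrite in_fsetU; case: (boolP (N \in R)) => NR.
    by apply/orP; left; rewrite mem_sep RA.
  by apply/orP; right; rewrite mem_sep RA.
have S0E R : N \notin R -> R `\ N = R.
  move=> NR; apply/fsetP => x; rewrite !inE.
  by case: eqVneq => [->|//]; rewrite (negbTE NR).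
have U : J1 `|` S0 `<=` reds (A `\ N).
  apply/fsubsetP => R; rewrite in_fsetU => /orP [/imfsetP [T /=]|].
    by rewrite mem_sep => /andP [TA _] ->; apply: subR.
  by rewrite mem_sep => /andP [/= RA NR]; rewrite -(S0E R NR); apply: subR.
exists (J1 `&` S0).
  have := cardfsUI J1 S0; have := fsubset_leq_card U; lia.
move=> R; rewrite in_fsetI => /andP [J1R S0R]; split.
  by apply: (fsubsetP U); rewrite in_fsetU J1R.
move=> x y; rewrite in_fsetD1 => /andP [xN xA]; rewrite in_fsetD1 => /andP [yN yA] xyN.
(* In [T] the element [N] is red, so [x] and [y] are not both red; in [R] it is blue, so they are
   not both blue. *)
case/imfsetP: J1R => T /=; rewrite mem_sep => /andP [/redsP [_ /(_ x y xA yA)] + NT] RE.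
move: S0R; rewrite mem_sep => /andP [/redsP [_ /(_ x y xA yA)] + /= NR].
rewrite /monochromatic xyN NA (negbTE NR) NT => /(_ isT) h0 /(_ isT).
have eT z : z != N -> (z \in T) = (z \in R) by move=> zN; rewrite RE !inE zN.
by move: h0; rewrite !eT //; do ![case: (_ \in _)].
Qed.

Lemma card_reds_pair_reds (A : {fset nat}) N :
  N \in A -> A `<=` interval 1 N ->
  #|` reds A| <= #|` reds (A `\ N)| + #|` pair_reds A N|.
Proof.
move=> NA /fsubsetP AN; have [J le HJ] := card_redsD1 NA.
apply: leq_trans le _; rewrite leq_add2l; apply: fsubset_leq_card.
apply/fsubsetP => R /HJ [RA H]; rewrite in_pair_reds RA /=.
apply/alternatingP => x y xA yA xy fxy; apply: H => //.
move: (xA) (yA); rewrite !in_fsetD1 => /andP [xN /AN +] /andP [yN /AN].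
rewrite !mem_interval; move: fxy; rewrite /pair_min; lia.
Qed.

Lemma card_reds_half (A : {fset nat}) m :
  0 < m -> m \in A -> m.*2 \in A -> #|` reds A| <= #|` reds (A `\ m.*2)|.
Proof.
move=> m0 mA NA; have [J le HJ] := card_redsD1 NA.
suff J0 : J = fset0 by move: le; rewrite J0 cardfs0 addn0.
apply/fsetP => R; rewrite in_fset0; apply/negP => /HJ [_ /(_ m m)].
have mD : m \in A `\ m.*2 by rewrite in_fsetD1 mA; lia.
by rewrite eqxx addnn => /(_ mD mD erefl).
Qed.

Lemma leq_card_pair_reds (A : {fset nat}) N :
  #|` pair_reds A N| <= 2 ^ #|` pair_min N @` (A `\ N)|.
Proof.
apply: leq_trans (card_alternating (pair_min N) (A `\ N)); apply: fsubset_leq_card.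
apply/fsubsetP => R; rewrite in_pair_reds => /andP [/redsP [RA _] aR].
by rewrite mem_sep fpowersetE RA.
Qed.

(** * Greedy choice of pairs in distinct classes *)

Lemma card_interval m n : #|` interval m n| = n.+1 - m.
Proof. by rewrite /interval card_fseq undup_id ?iota_uniq // size_iota. Qed.

Lemma card_seq_le (T : choiceType) (s : seq T) : #|` [fset x in s]| <= size s.
Proof. by rewrite card_fseq size_undup. Qed.

Lemma card_preim_seq (X : {fset nat}) (v : nat -> nat) (s : seq nat) :
  {in X &, injective v} -> #|` [fset x in X | v x \in s]| <= size s.
Proof.
move=> vinj; apply: leq_trans (card_seq_le s).
rewrite -(@card_image_in _ _ v) => [|x y]; last first.
  by rewrite !mem_sep => /andP [xX _] /andP [yX _]; apply: vinj.
apply: fsubset_leq_card; apply/fsubsetP => _ /imfsetP [x /= + ->].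
by rewrite mem_sep in_fset => /andP [].
Qed.

(** Undoes [pair_min]: every [x <= N] whose class is in [D] is listed. *)
Definition sym_closure (N : nat) (D : seq nat) : seq nat := D ++ [seq N - d | d <- D].

Lemma mem_sym_closure N D x : x <= N -> pair_min N x \in D -> x \in sym_closure N D.
Proof.
rewrite /pair_min mem_cat => xN; case: (leqP x (N - x)) => [_ ->//|_ xD].
by apply/orP; right; apply/mapP; exists (N - x) => //; rewrite subKn.
Qed.

Lemma size_sym_closure N D : size (sym_closure N D) = (size D).*2.
Proof. by rewrite size_cat size_map addnn. Qed.

(** A used class excludes at most two [x] directly and, [v] being injective, at most two through
    [v x]. Every chosen pair uses up two further classes. *)
Lemma greedy_pairs N (X : {fset nat}) (v : nat -> nat) s (D : seq nat) :
  {in X &, injective v} ->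
  (forall x, x \in X -> [/\ x <= N, v x <= N & pair_min N x != pair_min N (v x)]) ->
  uniq D -> 4 * (size D + s.*2) < #|` X| ->
  exists ts : seq (nat * nat), [/\ size ts = s,
    forall t, t \in ts -> t.1 \in X /\ t.2 = v t.1 &
    uniq ([seq pair_min N x | x <- ends ts] ++ D)].
Proof.
move=> vinj HX; elim: s D => [|s IH] D uD cX; first by exists [::].
have [x [xX xD vD]] : exists x, [/\ x \in X, pair_min N x \notin D & pair_min N (v x) \notin D].
  have : ~~ all (fun x => (pair_min N x \in D) || (pair_min N (v x) \in D)) X.
    apply/negP => /allP H.
    have sub : X `<=` [fset x in X | id x \in sym_closure N D] `|`
                 [fset x in X | v x \in sym_closure N D].
      apply/fsubsetP => x xX; have [xN vN _] := HX x xX.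
      rewrite in_fsetU !mem_sep xX /=.
      by case/orP: (H x xX) => /mem_sym_closure -> //; rewrite orbT.
    have c1 : #|` [fset x in X | id x \in sym_closure N D]| <= size (sym_closure N D).
      by apply: card_preim_seq.
    have c2 := card_preim_seq (sym_closure N D) vinj.
    have := leq_trans (fsubset_leq_card sub) (leq_cardU _ _).
    rewrite leqNgt => /negP; apply; apply: leq_ltn_trans (leq_add c1 c2) _.
    by apply: leq_ltn_trans cX; rewrite !size_sym_closure; clear; lia.
  by move=> /allPn [x xX]; rewrite negb_or => /andP [xD vD]; exists x.
have [xN vN xv] := HX x xX.
have [||ts [sts Hts uts]] := IH [:: pair_min N x, pair_min N (v x) & D].
- by rewrite /= inE negb_or xv xD vD.
- by move: cX; rewrite /= doubleS; congr (_ <= _); clear; lia.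
exists ((x, v x) :: ts); split.
- by rewrite /= sts.
- by move=> t; rewrite inE => /orP [/eqP ->|/Hts].
- move: uts; rewrite -[_ :: _ :: D]/([:: pair_min N x; pair_min N (v x)] ++ D).
  by rewrite (perm_uniq (permEl (perm_catCA _ _ _))).
Qed.

(* [N./2 \notin A] for even [N]: otherwise [N./2] determines the colour of [N]. *)
Definition has_top (A : {fset nat}) (N : nat) : Prop :=
  [/\ A `<=` interval 1 N, N \in A & forall x, x \in A -> x + x != N].

(** * Consequences of a large number of extendable colourings *)

Definition missing (A : {fset nat}) (N : nat) : {fset nat} :=
  [fset i in interval 1 N.-1./2 | (i \notin A) && (N - i \notin A)].

Lemma has_topP A N x : has_top A N -> x \in A `\ N -> [/\ x \in A, 0 < x < N & x + x != N].
Proof.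
move=> [/fsubsetP AN NA H]; rewrite in_fsetD1 => /andP [xN xA].
by move: (AN x xA); rewrite mem_interval; split=> //; [lia|apply: H].
Qed.

(** Every class has its smaller member in [[1, (N - 1)/2]], and the missing indices name no
    class. *)
Lemma card_pair_min A N : has_top A N ->
  #|` pair_min N @` (A `\ N)| + #|` missing A N| <= N.-1./2.
Proof.
move=> tA; have : #|` interval 1 N.-1./2| = N.-1./2 by rewrite card_interval subn1.
move=> <-; rewrite -(cardfsID (missing A N) (interval 1 _)) addnC.
have -> : interval 1 N.-1./2 `&` missing A N = missing A N.
  by apply/fsetP => i; rewrite in_fsetI mem_sep andbA andbb.
rewrite leq_add2l; apply: fsubset_leq_card; apply/fsubsetP => _ /imfsetP [x /= xA ->].
have [{}xA x0 xx] := has_topP tA xA; rewrite in_fsetD mem_sep !mem_interval.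
have fx : pair_min N x = x \/ N - pair_min N x = x by rewrite /pair_min; lia.
have fI : 0 < pair_min N x <= N.-1./2 by rewrite /pair_min; lia.
by rewrite fI /= andbT negb_and !negbK; case: fx => ->; rewrite xA ?orbT.
Qed.

Lemma card_missing A N : has_top A N -> 2 ^ N.-1./2 <= 4 * #|` pair_reds A N| ->
  #|` missing A N| <= 2.
Proof.
move=> tA le; have := leq_trans le (leq_mul (leqnn 4) (leq_card_pair_reds A N)).
rewrite -[4]/(2 ^ 2) -expnD leq_exp2l //; have := card_pair_min tA; clear; lia.
Qed.

(* With five triples through the same centre the count drops by (3/4)^5 < 1/4. *)
Lemma card_centre A N c (X : {fset nat}) (v : nat -> nat) :
  has_top A N -> 2 ^ N.-1./2 <= 4 * #|` pair_reds A N| ->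
  c \in A `\ N -> X `<=` A `\ N -> {in X &, injective v} ->
  (forall x, x \in X -> [/\ v x \in A `\ N, pair_min N x != pair_min N (v x) & schur3 c (x, v x)]) ->
  #|` X| <= 44.
Proof.
move=> tA le cA /fsubsetP XA vinj HX; rewrite leqNgt; apply/negP => X44.
(* Five pairs, with the class of [c] used from the start, need more than [4 * (1 + 10) = 44]
   elements. *)
have [|//|//|ts [sts Hts uts]] := @greedy_pairs N X v 5 [:: pair_min N c] vinj.
  move=> x xX; have [vA ne _] := HX x xX.
  have [_ /andP [_ /ltnW ?] _] := has_topP tA (XA x xX).
  by have [_ /andP [_ /ltnW ?] _] := has_topP tA vA.
have := @card_reds_star (pair_min N) (A `\ N) (pair_reds A N) c ts _ cA.
rewrite sts => star; suff : 4 ^ 5 * #|` pair_reds A N| <= 3 ^ 5 * 2 ^ N.-1./2.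
  move: le; have : 0 < 2 ^ N.-1./2 by rewrite expn_gt0.
  (* The contradiction is [4 * 243 < 1024]. *)
  rewrite -[4 ^ 5]/1024 -[3 ^ 5]/243; move: (2 ^ _) #|` _| => p q; clear; lia.
have ends_sub : {subset ends ts <= A `\ N}.
  move=> y /flattenP [s /mapP [t tts ->]]; have [t1 t2] := Hts t tts.
  by rewrite in_cons mem_seq1 => /orP [] /eqP ->; [exact: XA|rewrite t2; case: (HX _ t1)].
apply: leq_trans (star _ ends_sub _ _) _.
- by move=> R; rewrite in_pair_reds => /andP.
- by move: uts; rewrite -cat1s uniq_catC.
- apply/allP => t tts; have [t1 t2] := Hts t tts.
  by case: (HX _ t1) => _ _; rewrite -t2; case: (t).
rewrite leq_mul2l leq_exp2l //; have := card_pair_min tA; clear; lia.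
Qed.

Lemma pair_min_eq N x y : x <= N -> y <= N -> pair_min N x = pair_min N y -> x = y \/ x + y = N.
Proof. rewrite /pair_min; lia. Qed.

(** The triples [(j, x, x + j)] have centre [j]. The only [x] for which [x] and [x + j] share a
    class solves [2x + j = N]; setting it aside turns 44 into 45. *)
Lemma card_shift A N j : has_top A N -> 2 ^ N.-1./2 <= 4 * #|` pair_reds A N| ->
  j \in A `\ N -> #|` [fset x in A `\ N | x + j \in A `\ N]| <= 45.
Proof.
move=> tA le jA; set X := [fset x in _ | _].
have [_ /andP [j0 jN] _] := has_topP tA jA.
apply: (@leq_trans (#|` X `\ (N - j)./2|.+1)).
  by rewrite [X in X <= _](cardfsD1 (N - j)./2); case: (_ \in _).
apply: (@card_centre A N j _ (addn^~ j)) => //.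
- apply/fsubsetP => x; rewrite in_fsetD1 mem_sep; by case/and3P.
- by move=> x y _ _ /addIn.
move=> x; rewrite in_fsetD1 mem_sep => /and3P [xj xA xjA]; split=> //.
  apply/eqP => /pair_min_eq; have [_ _ _] := has_topP tA xA; have [_ + _] := has_topP tA xjA.
  by have [_ + _] := has_topP tA xA; move: xj jN j0; clear; lia.
by rewrite /schur3 /= addnC eqxx.
Qed.

(** The triples [(x, c - x, c)] have centre [c]. As [c < N], only [x = c/2] puts [x] and [c - x] in
    one class. *)
Lemma card_reflect A N c : has_top A N -> 2 ^ N.-1./2 <= 4 * #|` pair_reds A N| ->
  c \in A `\ N ->
  #|` [fset x in A `\ N | (x < c) && (c - x \in A `\ N)]| <= 45.
Proof.
move=> tA le cA; set X := [fset x in _ | _].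
have [_ /andP [c0 cN] _] := has_topP tA cA.
apply: (@leq_trans (#|` X `\ c./2|.+1)).
  by rewrite [X in X <= _](cardfsD1 c./2); case: (_ \in _).
apply: (@card_centre A N c _ (fun x => c - x)) => //.
- apply/fsubsetP => x; rewrite in_fsetD1 mem_sep; by case/and3P.
- move=> x y; rewrite !in_fsetD1 !mem_sep => /and4P [_ _ xc _] /and4P [_ _ yc _].
  by move: xc yc; clear; lia.
move=> x; rewrite in_fsetD1 mem_sep => /and4P [xj xA xc xjA]; split=> //.
  apply/eqP => /pair_min_eq; have [_ + _] := has_topP tA xjA.
  by have [_ + _] := has_topP tA xA; move: xj xc cN c0; clear; lia.
by rewrite /schur3 /=; move: xc; clear; lia.
Qed.

(** At most two pairs are missing, so the list has at most [1 + 2 * 2] entries. *)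
Lemma card_near_missing A N (v : nat -> nat) (X : {fset nat}) :
  has_top A N -> 2 ^ N.-1./2 <= 4 * #|` pair_reds A N| -> {in X &, injective v} ->
  #|` [fset x in X | v x \in N./2 :: sym_closure N (missing A N)]| <= 5.
Proof.
move=> tA le vinj; apply: leq_trans (card_preim_seq _ vinj) _.
by rewrite /= size_sym_closure ltnS (@leq_double _ 2) (card_missing tA le).
Qed.

Lemma notin_missing A N x : has_top A N -> 0 < x < N -> x \notin A -> N - x \notin A ->
  x \in N./2 :: sym_closure N (missing A N).
Proof.
move=> tA /andP [x0 xN] xA nxA; have [->|xh] := eqVneq x N./2; first exact: mem_head.
rewrite in_cons; apply/orP; right; have [xlt|xlt] := ltnP x N./2; last first.
  apply: mem_sym_closure; first exact: ltnW.
  have -> : pair_min N x = N - x by move: xlt xh; rewrite /pair_min; clear; lia.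
  rewrite mem_sep mem_interval subKn ?(ltnW xN) // xA nxA !andbT.
  by move: xN xlt xh; clear; lia.
apply: mem_sym_closure; first exact: ltnW.
have -> : pair_min N x = x by move: xlt; rewrite /pair_min; clear; lia.
rewrite mem_sep mem_interval xA nxA andbT.
by move: xN xlt xh x0; clear; lia.
Qed.

(* For [j] and [N - j] in [A], almost every [x < N - j] of [A] lies in a triple
   [(j, x, j + x)] or [(x, N - j - x, N - j)]. *)
Lemma card_low A N j : has_top A N -> 2 ^ N.-1./2 <= 4 * #|` pair_reds A N| ->
  j \in A -> N - j \in A -> j.*2 < N ->
  #|` A `&` interval 1 N.-1./2| <= 95.
Proof.
move=> tA le jA njA jN; have [/fsubsetP AN NA HA] := tA.
have j0 : 0 < j by move: (AN j jA); rewrite mem_interval => /andP [].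
have jA' : j \in A `\ N by rewrite in_fsetD1 jA andbT; lia.
have njA' : N - j \in A `\ N by rewrite in_fsetD1 njA andbT; lia.
have c1 := card_shift tA le jA'; have c2 := card_reflect tA le njA'.
have c3 := @card_near_missing A N (addn^~ j) A tA le (in2W (@addIn j)).
set X1 := [fset _ in _ | _] in c1; set X2 := [fset _ in _ | _] in c2.
set X3 := [fset _ in _ | _] in c3.
(* The sizes are at most 45, 45 and 5; the last set covers the [x] for which neither [x + j] nor
   [N - (x + j)] is in [A]. *)
suff sub : A `&` interval 1 N.-1./2 `<=` X1 `|` X2 `|` X3.
  apply: leq_trans (fsubset_leq_card sub) _; apply: leq_trans (leq_cardU _ _) _.
  by rewrite (@leq_add _ _ 90 5) // (leq_trans (leq_cardU _ _)) // (@leq_add _ _ 45 45).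
apply/fsubsetP => x; rewrite in_fsetI mem_interval => /andP [xA xM].
have xA' : x \in A `\ N by rewrite in_fsetD1 xA andbT; move: xM; clear; lia.
rewrite !in_fsetU !mem_sep xA' xA /=.
have xjN : 0 < x + j < N by move: xM j0 jN; clear; lia.
case: (boolP (x + j \in A)) => xjA.
  by rewrite in_fsetD1 xjA andbT; move: xjN => /andP [_ /ltn_eqF ->].
case: (boolP (N - (x + j) \in A)) => nxjA; last by rewrite (notin_missing tA) ?orbT.
have -> : (x < N - j) && (N - j - x \in A `\ N); last by rewrite orbT.
rewrite in_fsetD1 -subnDA (addnC j) nxjA andbT.
by move: xjN xM; clear; lia.
Qed.

(** Suppose [pair_reds] is large and some pair [{j, N - j}] lies in [A]. Then [A] has few low
    elements and few missing pairs, so it contains nearly all of the upper half. A low [l] far from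
    [N/2] would then have too many shifts [(x, l, x + l)] there. *)
Lemma pair_reds_trichotomy A N : 2000 <= N -> has_top A N ->
  [\/ 4 * #|` pair_reds A N| < 2 ^ N.-1./2,
      forall j, j \in A -> N - j \in A -> j = N |
      forall l, l \in A -> l.*2 <= N -> 3 * N < 8 * l].
Proof.
move=> N2000 tA; have [le|] := leqP (2 ^ N.-1./2) (4 * #|` pair_reds A N|); last by constructor 1.
have [/fsubsetP AN NA HA] := tA.
case: (boolP (all (fun j => (N - j \in A) ==> (j == N)) A)) => [/allP H|/allPn [j jA]].
  by constructor 2 => j jA njA; have := H j jA; rewrite njA => /eqP.
rewrite negb_imply => /andP [njA jN]; constructor 3 => l lA lN.
have low : #|` A `&` interval 1 N.-1./2| <= 95.
  have := HA j jA; have := AN j jA; rewrite mem_interval => j1 jj.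
  case: (ltnP j.*2 N) => jlt; first exact: card_low jA njA jlt.
  apply: (@card_low A N (N - j)) => //; last by move: jlt jj jN j1; clear; lia.
  by rewrite subKn //; move: j1; clear; lia.
have l0 : 0 < l by move: (AN l lA); rewrite mem_interval => /andP [].
have lA' : l \in A `\ N by rewrite in_fsetD1 lA andbT; move: lN N2000; clear; lia.
have c1 := card_shift tA le lA'; set X := [fset _ in _ | _] in c1.
have c2 := card_missing tA le.
rewrite ltnNge; apply/negP => lsmall.
pose bad := A `&` interval 1 N.-1./2 `|` missing A N.
have cbad : #|` bad| <= 97 by apply: leq_trans (leq_cardU _ _) _; rewrite (@leq_add _ _ 95 2).
have badP i : 0 < i <= N.-1./2 -> i \notin bad -> N - i \in A `\ N.
  move=> iM; rewrite in_fsetU in_fsetI mem_sep mem_interval iM andbT /= negb_or.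
  case: (i \in A) => //=; rewrite negbK in_fsetD1 => ->; rewrite andbT.
  by move: iM; clear; lia.
(* Unless [i] or [i - l] is bad, [N - i] and [N - i + l] both lie in [A]. Hence there are at most
   [97 + 97 + 45 = 239] such [i], while [8 * l <= 3 * N] gives at least [N/8 - 1 >= 249]. *)
have sub : interval l.+1 N.-1./2 `<=` bad `|` (addn^~ l) @` bad `|` (subn N) @` X.
  apply/fsubsetP => i; rewrite mem_interval => /andP [li iM].
  rewrite 2!in_fsetU -orbA; case: (boolP (i \in bad)) => //= ib.
  case: (boolP (i - l \in bad)) => ilb.
    by apply/orP; left; apply/imfsetP; exists (i - l) => //=; rewrite subnK // ltnW.
  apply/orP; right; apply/imfsetP; exists (N - i) => /=; last by move: iM; clear; lia.
  rewrite mem_sep badP //; last by move: li iM; clear; lia.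
  have -> : N - i + l = N - (i - l) by move: li iM; clear; lia.
  by rewrite badP //; move: li iM; clear; lia.
have := leq_trans (fsubset_leq_card sub) (leq_cardU _ _); rewrite card_interval.
have := leq_cardU bad ((addn^~ l) @` bad); have := leq_card_image (addn^~ l) bad.
have := leq_card_image (subn N) X.
move: c1 cbad lsmall N2000; rewrite -/X; move: #|` X| #|` bad|; clear => p q.
lia.
Qed.

(** * Low elements close to the middle: pairing [l] with [2l] *)

Definition double_low (N x : nat) : nat := if x.*2 <= N then x.*2 else x.

Lemma card_I2 n : #|` I2 n| = uphalf n.
Proof. by rewrite card_interval; lia. Qed.

Lemma dbl_sub_I2 A N : has_top A N -> (forall l, l \in A -> l.*2 <= N -> N < 3 * l) ->
  double_low N @` A `<=` I2 N.
Proof.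
move=> [/fsubsetP AN NA HA] H; apply/fsubsetP => _ /imfsetP [x /= xA ->].
have := H x xA; have := AN x xA; rewrite /I2 !mem_interval /double_low; clear.
by case: ifP; lia.
Qed.

(** Two elements of one class are some [l] and [2l], and [l + l = 2l] is a Schur triple. *)
Lemma alternating_dbl A N R : has_top A N -> R \in reds A -> alternating (double_low N) A R.
Proof.
move=> [/fsubsetP AN NA HA] /redsP [_ H]; apply/alternatingP => x y xA yA xy.
have nm a : a \in A -> a + a \in A -> (a \in R) != (a + a \in R).
  by move=> aA bA; have := H a a aA aA bA; rewrite /monochromatic andbb.
rewrite /double_low; case: ifP => hx; case: ifP => hy E.
- by move: xy E; clear; lia.
- by have := nm x xA; rewrite addnn E; apply.
- by have := nm y yA; rewrite addnn -E eq_sym; apply.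
- by rewrite E eqxx in xy.
Qed.

(** All classes are named by elements of [I2 N], so a full count means that every such name occurs.
    A low [l] would then give a triple [(l, N - l, N)] in three different classes, which costs a
    factor 3/4. *)
Lemma card_reds_dbl_eq A N : has_top A N -> (forall l, l \in A -> l.*2 <= N -> N < 3 * l) ->
  2 ^ uphalf N <= #|` reds A| -> A = I2 N.
Proof.
move=> tA H le; have [/fsubsetP AN NA HA] := tA.
have sub := dbl_sub_I2 tA H.
have dblE : double_low N @` A = I2 N.
  apply/eqP; rewrite eqEfcard sub card_I2 /=.
  have := leq_trans le (card_reds_classes (fun R RA => alternating_dbl tA RA)).
  by rewrite leq_exp2l.
have big l : l \in A -> N < l.*2.
  move=> lA; rewrite ltnNge; apply/negP => lN.
  have l3 := H l lA lN; have l2 := HA l lA; have := AN l lA; rewrite mem_interval => l1.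
  (* Doubles of low elements exceed [2N/3], while [N - l] is smaller; so this name can only come
     from [N - l] itself. *)
  have nlA : N - l \in A.
    have : N - l \in double_low N @` A.
      by rewrite dblE mem_interval; move: l1 l2 lN; clear; lia.
    case/imfsetP => x /= xA; rewrite /double_low; case: ifP => [xN xE|_ ->//].
    by have := H x xA xN; move: xE l3 l1; clear; lia.
  have := @card_reds_star (double_low N) A (reds A) l [:: (N - l, N)] _ lA.
  rewrite /= !expn1 dblE card_I2 => /(_ (fun R RA => conj RA (alternating_dbl tA RA))) star.
  have : 4 * #|` reds A| <= 3 * 2 ^ uphalf N.
    apply: star.
    - by move=> x; rewrite in_cons mem_seq1 => /orP [] /eqP ->.
    - have -> : double_low N l = l.*2 by rewrite /double_low lN.
      have -> : double_low N (N - l) = N - l by rewrite /double_low ifF //; move: l1 l2 lN; clear; lia.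
      have -> : double_low N N = N by rewrite /double_low ifF //; move: l1; clear; lia.
      by rewrite !inE !andbT; move: l1 l2 lN l3; clear; lia.
    - by rewrite /schur3 /=; move: l1; clear; lia.
  have : 0 < 2 ^ uphalf N by rewrite expn_gt0.
  by move: le; move: (2 ^ _) #|` _| => p q; clear; lia.
rewrite -dblE; apply/fsetP => x; apply/idP/imfsetP => [xA|[y /= yA ->]].
  by exists x => //=; rewrite /double_low leqNgt big.
by rewrite /double_low leqNgt big.
Qed.

(** * Sum-free sets with exactly one member of each pair *)

(** Argue by the least element [a]. If [2a > N], all of [I2 N] is forced; if [a = 1], the odd
    numbers are. Every other value produces a Schur triple. *)
Lemma sum_free_extremal A N : 20 <= N -> has_top A N -> sum_free A ->
  (forall x, 0 < x < N -> x + x != N -> (x \in A) = (N - x \notin A)) ->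
  A = odd_set N \/ A = I2 N.
Proof.
move=> N20 [/fsubsetP AN NA HA] /sum_freeP sf Hc.
have compl x : 0 < x < N -> x + x != N -> x \notin A -> N - x \in A.
  by move=> x1 x2; rewrite (Hc x) // negbK.
have compl' x : 0 < x < N -> x + x != N -> N - x \notin A -> x \in A.
  by move=> x1 x2; rewrite (Hc x).
have [a aA amin] : exists2 a, a \in A & forall x, x \in A -> a <= x.
  have exA : exists x, x \in A by exists N.
  by case: (ex_minnP exA) => a aA amin; exists a.
have lta x : x < a -> x \notin A.
  by move=> xa; apply/negP => /amin; rewrite leqNgt xa.
have a0 : 0 < a by have := AN a aA; rewrite mem_interval => /andP [].
have sumF x y z : x \in A -> y \in A -> z \in A -> x + y = z -> False.
  by move=> xA yA zA E; have := sf x y xA yA; rewrite E zA.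
have sumN x y z : x \in A -> y \in A -> x + y = z -> z \notin A.
  by move=> xA yA <-; apply: sf.
have aN : a + a != N := HA a aA.
have [big|small] := ltnP N a.*2.
  right; apply/fsetP => x; rewrite mem_interval; apply/idP/idP => [xA|xI].
    have := AN x xA; have := amin x xA; rewrite mem_interval.
    by move: big; clear; lia.
  have [->//|xN] := eqVneq x N.
  apply: compl'; [move: xI xN; clear; lia|move: xI; clear; lia|].
  by apply: lta; move: xI big; clear; lia.
left; have {small aN} aN : a.*2 < N by move: small aN; clear; lia.
(* Since [y - a < a], the number [N - (y - a)] is in [A]; it equals [a + (N - y)], so [N - y] is
   not. *)
have mid y : a < y < a.*2 -> y.*2 != N -> y \in A.
  move=> ya yN; apply: compl'; [by move: ya aN; clear; lia|by rewrite addnn|].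
  have w : N - (y - a) \in A.
    by apply: compl; [move: ya aN; clear; lia..|apply: lta; move: ya; clear; lia].
  apply/negP => nyA; apply: (sumF _ _ _ aA nyA w); move: ya aN; clear; lia.
have a2N : a.*2 \notin A by rewrite -addnn; apply: sf.
have [a3|a3] := leqP 3 a; last have [a2|a2] := leqP 2 a.
- exfalso.
  have N2A : N - 2 \in A by apply: compl; [lia|lia|exact: lta].
  (* Generically [(2a - 2) + (N - 2a) = N - 2] is a triple in [A]. It fails if a summand is [N/2],
     and then [(2a - 1) + (N - 2a - 1) = N - 2] serves. *)
  have [/andP [N4 N44]|N4] := boolP ((N != 4 * a) && (N != 4 * a - 4)).
    have yA : a.*2 - 2 \in A by apply: mid; move: N44 a3; clear; lia.
    have wA : N - a.*2 \in A by apply: compl => //; move: N4 aN a0; clear; lia.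
    by apply: (sumF _ _ _ yA wA N2A); move: aN a3; clear; lia.
  have a1A : a.+1 \in A by apply: mid; move: N4 a3 N20; clear; lia.
  have yA : a.*2 - 1 \in A by apply: mid; move: N4 a3; clear; lia.
  have zA : a.*2.+1 \notin A by apply: (sumN _ _ _ aA a1A); clear; lia.
  have wA : N - a.*2.+1 \in A by apply: compl => //; move: N4 aN a3; clear; lia.
  by apply: (sumF _ _ _ yA wA N2A); move: N4 aN a3; clear; lia.
- exfalso; have aE : a = 2 by move: a3 a2; clear; lia.
  rewrite aE in aA a2N mid lta.
  have N1A : N - 1 \in A by apply: compl; [lia|lia|exact: lta].
  have A3 : 3 \in A by apply: mid; lia.
  have N4A : N - 4 \in A by apply: compl; [lia|lia|exact: a2N].
  by apply: (sumF _ _ _ A3 N4A N1A); lia.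
have aE : a = 1 by move: a0 a2; clear; lia.
rewrite aE in aA.
(* From [x] to [x + 2]: [1 + x] is excluded, so [N - x - 1] is in [A]; this excludes [N - x - 2],
   hence [x + 2] is in [A]. *)
have low_odd i : (i.*2.+1).*2 < N -> i.*2.+1 \in A.
  elim: i => [//|i IH] iN; have {IH}iA : i.*2.+1 \in A by apply: IH; move: iN; clear; lia.
  have i2 : i.*2.+2 \notin A by apply: (sumN _ _ _ aA iA).
  have w : N - i.*2.+2 \in A by apply: compl => //; move: iN; clear; lia.
  apply: compl'; [move: iN; clear; lia..|].
  by apply/negP => w'; apply: (sumF _ _ _ aA w' w); move: iN; clear; lia.
have low x : 0 < x -> x.*2 < N -> (x \in A) = odd x.
  move=> x0 xN; have := odd_double_half x; case: (odd x) => xE.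
    by rewrite -xE add1n low_odd //; move: xE xN; clear; lia.
  apply/negbTE; have yA : x./2.-1.*2.+1 \in A.
    by apply: low_odd; move: xE xN x0; rewrite add0n; clear; lia.
  by apply: (sumN _ _ _ aA yA); move: xE x0; clear; lia.
have high x : N < x.*2 -> x < N -> (x \in A) = ~~ odd (N - x).
  move=> x0 xN; rewrite Hc; [|move: x0 xN; clear; lia..].
  by rewrite low //; move: x0 xN; clear; lia.
(* For even [N] the even numbers between [N/2] and [N] would lie in [A]. The first of them, [e'], is
   the sum of 3 and the odd number [e' - 3] below [N/2]. *)
have oN : odd N.
  apply/negPn/negP => eN; pose e := (N./2).+1 + ~~ odd (N./2).+1.-1.
  pose e' := N./2 + 2 - odd (N./2).
  have ee : odd e' = false by rewrite /e'; clear; lia.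
  have e'A : e' \in A by rewrite high /e'; lia.
  have A3 : 3 \in A by rewrite low //; lia.
  have wA : e' - 3 \in A by rewrite low /e'; lia.
  by apply: (sumF _ _ _ A3 wA e'A); rewrite /e'; lia.
apply/fsetP => x; rewrite mem_sep mem_interval.
case: (boolP (1 <= x <= N)) => xI; last by apply/negP => /AN; rewrite mem_interval (negbTE xI).
have [->|xN] := eqVneq x N; first by rewrite NA oN.
have [xl|xl] := ltnP x.*2 N; first by rewrite low //; case/andP: xI.
rewrite high; lia.
Qed.

Lemma card_reds_no_pair A N : 20 <= N -> has_top A N ->
  (forall j, j \in A -> N - j \in A -> j = N) ->
  #|` A| <= (N.-1./2).+1.
Proof.
move=> N20 tA H; have [AN NA HA] := tA.
rewrite (cardfsD1 N) NA add1n ltnS.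
rewrite -(@card_image_in _ _ (pair_min N)); first by have := card_pair_min tA; clear; lia.
move=> x y xA yA; have [xA' /andP [x0 xN] _] := has_topP tA xA.
have [yA' /andP [y0 yN] _] := has_topP tA yA.
case/pair_min_eq; [exact: ltnW|exact: ltnW|by []|move=> xyN].
have := H x xA'; have -> : N - x = y by move: xyN; clear; lia.
by move=> /(_ yA') E; rewrite E ltnn in xN.
Qed.

(** A smaller set has at most half of [2 ^ (N.-1./2).+1] colourings, and a set that is not sum-free
    at most 3/4. So [A] is sum-free of full size, which leaves no pair missing. *)
Lemma no_pair_extremal A N : 20 <= N -> has_top A N ->
  (forall j, j \in A -> N - j \in A -> j = N) ->
  3 * 2 ^ (N.-1./2).+1 < 4 * #|` reds A| -> A = odd_set N \/ A = I2 N.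
Proof.
move=> N20 tA H le; have cA := card_reds_no_pair N20 tA H; have [/fsubsetP AN NA HA] := tA.
have p2 : 0 < 2 ^ (N.-1./2).+1 by rewrite expn_gt0.
have cAE : #|` A| = (N.-1./2).+1.
  apply/eqP; rewrite eqn_leq cA leqNgt; apply/negP => clt.
  have : #|` reds A| <= 2 ^ N.-1./2.
    by apply: leq_trans (card_reds_le A) _; rewrite leq_exp2l // -ltnS.
  by move: le p2; rewrite expnS; move: (2 ^ _) #|` _| => p q; clear; lia.
have sfA : sum_free A.
  have A0 : 0 \notin A by apply/negP => /AN; rewrite mem_interval.
  case: (boolP (sum_free A)) => // nsf; have := card_reds_not_sum_free A0 nsf.
  by rewrite cAE leqNgt le.
apply: sum_free_extremal => // x xN xx.
have mis : missing A N = fset0.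
  apply/eqP; rewrite -cardfs_eq0 -leqn0.
  have := card_pair_min tA; rewrite card_image_in; last first.
    move=> u v uA vA; have [uA' /andP [u0 uN] _] := has_topP tA uA.
    have [vA' /andP [v0 vN] _] := has_topP tA vA.
    case/pair_min_eq; [exact: ltnW|exact: ltnW|by []|move=> xyN].
    have := H u uA'; have -> : N - u = v by move: xyN; clear; lia.
    by move=> /(_ vA') E; rewrite E ltnn in uN.
  by have := cardfsD1 N A; rewrite NA cAE; move: #|` _| #|` _| => p q; clear; lia.
case: (boolP (x \in A)) => xA.
  apply/esym/negP => nxA; have := H x xA nxA; move: xN; clear; lia.
apply/esym/negbTE; rewrite negbK; apply/negPn/negP => nxA.
suff : pair_min N x \in missing A N by rewrite mis.
have fI : 0 < pair_min N x <= N.-1./2 by move: xN xx; rewrite /pair_min; clear; lia.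
rewrite mem_sep mem_interval fI /=.
have [->|->] : pair_min N x = x \/ pair_min N x = N - x by move: xN; rewrite /pair_min; clear; lia.
  by rewrite xA.
by rewrite subKn ?nxA ?xA //; move: xN; clear; lia.
Qed.

(** * Counts for the extremal sets and a near-extremal one *)

Lemma card_odd_set n : #|` odd_set n| = uphalf n.
Proof.
have -> : odd_set n = [fset x in [seq i.*2.+1 | i <- iota 0 (uphalf n)]].
  apply/fsetP => x; rewrite mem_sep mem_interval in_fset /=.
  apply/andP/mapP => [[xn ox]|[i]].
    by exists x./2; rewrite ?mem_iota; move: xn ox; clear; lia.
  by rewrite mem_iota => i_n ->; move: i_n; clear; lia.
rewrite card_fseq undup_id ?size_map ?size_iota // map_inj_uniq ?iota_uniq //.
by move=> i j; clear; lia.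
Qed.

Lemma sum_free_interval m n : n < m.*2 -> sum_free (interval m n).
Proof. by move=> nm; apply/sum_freeP => x y; rewrite !mem_interval; lia. Qed.

Lemma sum_free_odd_set n : sum_free (odd_set n).
Proof.
apply/sum_freeP => x y; rewrite !mem_sep => /andP [_ ox] /andP [_ oy].
by rewrite oddD ox oy andbF.
Qed.

Lemma card_reds_odd_set n : #|` reds (odd_set n)| = 2 ^ uphalf n.
Proof. by rewrite card_reds_sum_free ?sum_free_odd_set // card_odd_set. Qed.

Lemma card_reds_interval m n : n < m.*2 -> #|` reds (interval m n)| = 2 ^ (n.+1 - m).
Proof. by move=> nm; rewrite card_reds_sum_free ?sum_free_interval // card_interval. Qed.

Lemma card_reds_I2 n : #|` reds (I2 n)| = 2 ^ uphalf n.
Proof. by rewrite card_reds_interval; [congr (_ ^ _)|]; lia. Qed.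

(** The only triple is [m + m = 2m]: colour [[m, 2m - 1]] freely and give [2m] the colour opposite
    to that of [m], as [phi] does. *)
Lemma card_reds_sym_interval m : 0 < m -> #|` reds (interval m m.*2)| = 2 ^ m.
Proof.
move=> m0; apply/eqP; rewrite eqn_leq; apply/andP; split.
  have := @card_reds_half (interval m m.*2) m m0.
  rewrite !mem_interval => /(_ _ _)/leq_trans; apply; [lia..|].
  have -> : interval m m.*2 `\ m.*2 = interval m m.*2.-1.
    by apply/fsetP => x; rewrite in_fsetD1 !mem_interval; lia.
  by rewrite card_reds_interval ?leq_exp2l; lia.
pose phi (R : {fset nat}) := if m \in R then R else m.*2 |` R.
have NR R : R \in fpowerset (interval m m.*2.-1) -> m.*2 \notin R.
  by rewrite fpowersetE => /fsubsetP RA; apply/negP => /RA; rewrite mem_interval; lia.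
have phiK R : R \in fpowerset (interval m m.*2.-1) -> phi R `\ m.*2 = R.
  move=> /NR nR; apply/fsetP => x; rewrite in_fsetD1 /phi; case: ifP => _.
    by have [->|] := eqVneq x m.*2; rewrite ?(negbTE nR).
  by rewrite in_fset1U; have [->|] := eqVneq x m.*2; rewrite ?(negbTE nR).
have -> : 2 ^ m = #|` phi @` fpowerset (interval m m.*2.-1)|.
  rewrite card_image_in ?card_fpowerset ?card_interval; first by congr (2 ^ _); lia.
  by move=> R R' /phiK {2}<- /phiK {2}<- ->.
apply/fsubset_leq_card/fsubsetP => _ /imfsetP [R /= RI ->].
have /fsubsetP RA : R `<=` interval m m.*2.-1 by rewrite -fpowersetE.
have nR := NR R RI.
apply/redsP; split.
  apply/fsubsetP => x; rewrite /phi; case: ifP => _; rewrite ?in_fset1U.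
    by move=> /RA; rewrite !mem_interval; lia.
  by case/orP => [/eqP ->|/RA]; rewrite !mem_interval; lia.
move=> x y; rewrite !mem_interval => xI yI zI.
have -> : x = m by lia.
have -> : y = m by lia.
rewrite addnn /monochromatic andbb /phi; case: ifP => [->|mR]; first by rewrite (negbTE nR).
by rewrite !in_fset1U mR eqxx orbF; lia.
Qed.

(** Three triples with sum [n] outweigh the one extra element: [2 * 27/64 < 1]. *)
Lemma card_reds_odd_set_U1 A n : 20 <= n -> ~~ odd n -> n \in A ->
  A `\ n = odd_set n.-1 -> #|` reds A| < 2 ^ n./2.
Proof.
move=> n20 en nA AE.
have oA x : 0 < x < n -> odd x -> x \in A.
  move=> xn ox; have : x \in A `\ n by rewrite AE mem_sep mem_interval ox; lia.
  by rewrite in_fsetD1 => /andP [].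
have cA : #|` id @` A| = (n./2).+1.
  rewrite card_image_in // (cardfsD1 n) nA AE card_odd_set; move: en n20; clear; lia.
have star := @card_reds_star id A (reds A) n [:: (1, n - 1); (3, n - 3); (5, n - 5)] _ nA.
have : 4 ^ 3 * #|` reds A| <= 3 ^ 3 * 2 ^ (n./2).+1.
  rewrite -cA; apply: star.
  - by move=> R RA; split=> //; exact: alternating_id.
  - move=> x; rewrite /ends /= !in_cons in_nil orbF => xs.
    by apply: oA; move: xs en n20; clear; lia.
  - by rewrite /= !inE; move: en n20; clear; lia.
  - by rewrite /= /schur3 /=; move: n20; clear; lia.
have : 0 < 2 ^ n./2 by rewrite expn_gt0.
by rewrite -[4 ^ 3]/64 -[3 ^ 3]/27 expnS; move: (2 ^ _) #|` _| => p q; clear; lia.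
Qed.

(** * One step of the induction *)

Lemma no_pair_step A N : 20 <= N -> has_top A N ->
  (forall j, j \in A -> N - j \in A -> j = N) ->
  [\/ 4 * #|` reds A| <= 3 * 2 ^ (N.-1./2).+1, A = odd_set N | A = I2 N].
Proof.
move=> N20 tA H; have [le|lt] := leqP (4 * #|` reds A|) (3 * 2 ^ (N.-1./2).+1).
  by constructor 1.
by have [->|->] := no_pair_extremal N20 tA H lt; [constructor 2|constructor 3].
Qed.

Lemma dbl_step A N : has_top A N -> (forall l, l \in A -> l.*2 <= N -> N < 3 * l) ->
  #|` reds A| < 2 ^ uphalf N \/ A = I2 N.
Proof.
move=> tA H; have [lt|le] := ltnP #|` reds A| (2 ^ uphalf N); first by left.
by right; apply: card_reds_dbl_eq.
Qed.

Lemma odd_has_top A N : A `<=` interval 1 N -> N \in A -> odd N -> has_top A N.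
Proof. by move=> AN NA oN; split=> // x _; lia. Qed.

(** Outside the other cases [N] adds at most a quarter of [2 ^ N./2], against the full power in the
    trivial bound. *)
Lemma odd_step A N : 2000 <= N -> odd N -> A `<=` interval 1 N -> N \in A ->
  [\/ 4 * #|` reds A| <= 4 * #|` reds (A `\ N)| + 2 ^ N./2,
      #|` reds A| < 2 ^ uphalf N, A = odd_set N | A = I2 N].
Proof.
move=> N2000 oN AN NA; have tA := odd_has_top AN NA oN.
have NE : N.-1./2 = N./2 by move: oN; clear; lia.
have uE : uphalf N = (N./2).+1 by move: oN; clear; lia.
have p0 : 0 < 2 ^ N./2 by rewrite expn_gt0.
case: (pair_reds_trichotomy N2000 tA) => [lt|H|H].
- constructor 1; have := card_reds_pair_reds NA AN; move: lt; rewrite NE.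
  by move: (2 ^ _) #|` reds A| #|` reds _| #|` _| => p q r s; clear; lia.
- have N20 : 20 <= N by move: N2000; clear; lia.
  case: (no_pair_step N20 tA H) => [le|->|->]; [constructor 2|by constructor 3|by constructor 4].
  move: le p0; rewrite NE uE expnS.
  by move: (2 ^ _) #|` reds A| => p q; clear; lia.
- case: (dbl_step tA) => [l lA lN|lt|->]; [|by constructor 2|by constructor 4].
  by have := H l lA lN; move: N2000; clear; lia.
Qed.

(** The odd bound for [n - 1] is already [2 ^ n./2], so removing [n] alone leaves no room; [n - 1]
    is removed as well. *)
Lemma even_step A n : 2002 <= n -> ~~ odd n -> has_top A n ->
  [\/ 4 * #|` reds A| <= 4 * #|` reds (A `&` interval 1 n.-2)| + 2 ^ n./2,
      #|` reds A| < 2 ^ n./2 | A = I2 n].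
Proof.
move=> n2002 en tA; have [AN nA HA] := tA; have /fsubsetP AN' := AN.
have NE : n.-1./2.+1 = n./2 by move: en n2002; clear; lia.
have uE : uphalf n = n./2 by move: en; clear; lia.
have p0 : 0 < 2 ^ n.-1./2 by rewrite expn_gt0.
have n2000 : 2000 <= n by move: n2002; clear; lia.
have n20 : 20 <= n by move: n2002; clear; lia.
case: (pair_reds_trichotomy n2000 tA) => [lt|H|H]; last 2 first.
- case: (no_pair_step n20 tA H) => [le|AE|->]; last by constructor 3.
    constructor 2; move: le p0; rewrite -NE expnS.
    by move: (2 ^ _) #|` reds A| => p q; clear; lia.
  by move: nA; rewrite AE mem_sep (negbTE en) andbF.
- case: (dbl_step tA) => [l lA lN|lt|->]; last by constructor 3.
    by have := H l lA lN; move: n2002; clear; lia.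
  by constructor 2; rewrite -uE.
have := card_reds_pair_reds nA AN; set B := A `\ n; set F := #|` pair_reds A n| in lt *.
have [n1A|n1A] := boolP (n.-1 \in A); last first.
  have -> : B = A `&` interval 1 n.-2.
    apply/fsetP => x; rewrite in_fsetD1 in_fsetI mem_interval.
    case: (boolP (x \in A)) => xA; rewrite ?andbF //=.
    have := AN' x xA; rewrite mem_interval => xI.
    have xn1 : x != n.-1 by apply: contraNneq n1A => <-.
    by move: xI xn1; clear; lia.
  move=> le; constructor 1; move: le lt; rewrite -NE expnS.
  by move: (2 ^ _) #|` reds A| #|` reds _| F => p q r s; clear; lia.
have BN : B `<=` interval 1 n.-1.
  apply/fsubsetP => x; rewrite in_fsetD1 => /andP [xn /AN']; rewrite !mem_interval.
  by move: xn; clear; lia.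
have n1B : n.-1 \in B by rewrite in_fsetD1 n1A andbT; move: n2002; clear; lia.
have on1 : odd n.-1 by move: en n2002; clear; lia.
have tB := odd_has_top BN n1B on1.
have n12000 : 2000 <= n.-1 by move: n2002; clear; lia.
have n120 : 20 <= n.-1 by move: n2002; clear; lia.
have N1E : n.-1.-1./2 = n.-1./2 by move: en n2002; clear; lia.
move=> le; have := pair_reds_trichotomy n12000 tB; rewrite N1E => -[lt'|H|H].
(* Two terms below a quarter of [2 ^ n.-1./2] sum to less than a quarter of [2 ^ n./2]. *)
- constructor 1; have := card_reds_pair_reds n1B BN.
  have -> : B `\ n.-1 = A `&` interval 1 n.-2.
    apply/fsetP => x; rewrite !in_fsetD1 in_fsetI mem_interval.
    case: (boolP (x \in A)) => xA; rewrite ?andbF //=.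
    by have := AN' x xA; rewrite mem_interval; clear; lia.
  move: le lt lt'; rewrite -NE expnS.
  by move: (2 ^ _) #|` reds A| #|` reds B| #|` reds _| F #|` _| => p q r s t u; clear; lia.
- have := no_pair_step n120 tB H; rewrite N1E => -[le'|BE|BE].
  + constructor 2; move: le le' lt p0; rewrite -NE expnS.
    by move: (2 ^ _) #|` reds A| #|` reds B| F => p q r s; clear; lia.
  + by constructor 2; apply: card_reds_odd_set_U1.
  (* [I2 n.-1] starts at [n/2], which [has_top A n] forbids. *)
  + have : n./2 \in B by rewrite BE mem_interval; move: en n2002; clear; lia.
    rewrite in_fsetD1 => /andP [_ /HA]; move: en; clear; lia.
(* [8l > 3(n - 1)] still gives [3l > n], so the doubling argument applies to [A] itself. *)
- case: (dbl_step tA) => [l lA lN|lt'|->]; last by constructor 3.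
    have lB : l \in B by rewrite in_fsetD1 lA andbT; move: lN n2002; clear; lia.
    have := H l lB; have := HA l lA; move: lN n2002; clear; lia.
  by constructor 2; rewrite -uE.
Qed.

(** * A bound with an additive error *)

Lemma reds_pred (A : {fset nat}) n : A `<=` interval 1 n -> n \notin A ->
  A `<=` interval 1 n.-1.
Proof.
move=> /fsubsetP AN nA; apply/fsubsetP => x xA; have := AN x xA.
have xn : x != n by apply: contraNneq nA => <-.
by rewrite !mem_interval; move: xn; clear; lia.
Qed.

Lemma sub_D1 (A : {fset nat}) n : A `<=` interval 1 n -> A `\ n `<=` interval 1 n.-1.
Proof.
move=> AN; apply: reds_pred; last by rewrite in_fsetD1 eqxx.
exact: fsubset_trans (fsubD1set _ _) AN.
Qed.

(* Each step passes the additive error on unchanged, so it stays what the trivial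
   bound gives for small [m]. *)
Lemma card_reds_weak m (A : {fset nat}) : A `<=` interval 1 m.*2 ->
  #|` reds A| <= 2 ^ m + 2 ^ 2002.
Proof.
elim: m A => [|m IH] A AN.
  apply: leq_trans (card_reds_le A) _; apply: leq_trans (leq_addl _ _).
  rewrite leq_exp2l //; apply: leq_trans (fsubset_leq_card AN) _.
  by rewrite card_interval; lia.
have [msmall|mbig] := leqP m 1000.
  apply: leq_trans (card_reds_le A) _; apply: leq_trans (leq_addl _ _).
  rewrite leq_exp2l //; apply: leq_trans (fsubset_leq_card AN) _.
  by rewrite card_interval; lia.
set X := 2 ^ 2002 in IH *; clearbody X.
(* An odd top element has [m] pairs below it and adds at most [2 ^ m], which doubles the main term
   and keeps the error. *)
have oddB (B : {fset nat}) : B `<=` interval 1 m.*2.+1 -> #|` reds B| <= 2 ^ m.+1 + X.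
  move=> BN; have [NB|NB] := boolP (m.*2.+1 \in B); last first.
    apply: leq_trans (IH _ (reds_pred BN NB)) _.
    by rewrite leq_add2r leq_exp2l.
  apply: leq_trans (card_reds_pair_reds NB BN) _.
  have -> : 2 ^ m.+1 + X = 2 ^ m + X + 2 ^ m by rewrite expnS; clear; lia.
  apply: leq_add.
    exact: IH (sub_D1 BN).
  apply: leq_trans (leq_card_pair_reds _ _) _; rewrite leq_exp2l //.
  have oN : odd m.*2.+1 by rewrite /= odd_double.
  by have := card_pair_min (odd_has_top BN NB oN); clear; lia.
have [nA|nA] := boolP (m.+1.*2 \in A); last exact: oddB (reds_pred AN nA).
have [mA|mA] := boolP (m.+1 \in A).
  exact: leq_trans (card_reds_half (ltn0Sn m) mA nA) (oddB _ (sub_D1 AN)).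
have tA : has_top A m.+1.*2.
  by split=> // x xA; apply: contraNneq mA; rewrite addnn => /double_inj <-.
have mE : m.+1.*2./2 = m.+1 by rewrite doubleK.
case: (@even_step A m.+1.*2) => //; rewrite ?mE.
- by move: mbig; clear; lia.
- by rewrite odd_double.
- have := IH (A `&` interval 1 m.*2) (fsubsetIr _ _).
  rewrite doubleS /= expnS; move: (2 ^ m) #|` reds _| #|` reds A| => p q r.
  by clear; lia.
- by move/ltnW/leq_trans; apply; apply: leq_addr.
- by move=> ->; rewrite card_reds_I2 uphalf_double leq_addr.
Qed.

(** * Extremal sets for odd and even [n] *)

Lemma error_small m : 2010 <= m -> 16 * 2 ^ 2002 < 2 ^ m.
Proof.
move=> m2010; apply: (@leq_trans (2 ^ 2007)); last by rewrite leq_exp2l // (leq_trans _ m2010).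
by rewrite -[16]/(2 ^ 4) -expnD ltn_exp2l.
Qed.

(** Without [N] the weak bound gives about half the required count. With [N], the first case of
    [odd_step] gives about 5/8 of it, and the error is too small to fill the gap. *)
Lemma extremal_odd N A : 4500 <= N -> odd N -> A `<=` interval 1 N ->
  2 ^ uphalf N <= #|` reds A| -> A = odd_set N \/ A = I2 N.
Proof.
move=> N4500 oN AN le.
have NE : N.-1 = (N./2).*2 by move: oN; clear; lia.
have uE : uphalf N = (N./2).+1 by move: oN; clear; lia.
have X : 16 * 2 ^ 2002 < 2 ^ N./2 by apply: error_small; move: N4500; clear; lia.
have [NA|NA] := boolP (N \in A); last first.
  have := reds_pred AN NA; rewrite NE => /card_reds_weak.
  move: le X; rewrite uE expnS; move: (2 ^ N./2) (2 ^ 2002) #|` _| => p x q.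
  by clear; lia.
have N2000 : 2000 <= N by move: N4500; clear; lia.
case: (odd_step N2000 oN AN NA) => [le'|lt|->|->]; [|by rewrite leqNgt lt in le|by left|by right].
have := sub_D1 AN; rewrite NE => /card_reds_weak.
move: le le' X; rewrite uE expnS; move: (2 ^ N./2) (2 ^ 2002) #|` _| #|` reds _| => p x q r.
by clear; lia.
Qed.

(** If [n] is absent, or [n/2] is present and dictates the colour of [n], the odd case for [n - 1]
    applies. Otherwise [even_step] gives at most about 3/4 of the count in its first case. *)
Lemma extremal_even n A : 4502 <= n -> ~~ odd n -> A `<=` interval 1 n ->
  2 ^ uphalf n <= #|` reds A| ->
  [\/ A = odd_set n, A = I2 n, A = interval n./2 n.-1 | A = interval n./2 n].
Proof.
move=> n4502 en AN le.
have nE : n = (n./2).*2 by move: en; clear; lia.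
have uE : uphalf n = n./2 by move: en; clear; lia.
have u1E : uphalf n.-1 = n./2 by move: en n4502; clear; lia.
have n14500 : 4500 <= n.-1 by move: n4502; clear; lia.
have on1 : odd n.-1 by move: en n4502; clear; lia.
have I2E : I2 n.-1 = interval n./2 n.-1.
  by rewrite /I2; congr interval; move: en n4502; clear; lia.
have [nA|nA] := boolP (n \in A); last first.
  have := extremal_odd n14500 on1 (reds_pred AN nA).
  rewrite u1E; move: le; rewrite uE => le /(_ le) [->|->].
    constructor 1; apply/fsetP => x; rewrite !mem_sep !mem_interval; move: en; clear; lia.
  by constructor 3; rewrite I2E.
have [mA|mA] := boolP (n./2 \in A).
  have := extremal_odd n14500 on1 (sub_D1 AN); rewrite u1E.
  have m0 : 0 < n./2 by move: n4502; clear; lia.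
  have := card_reds_half m0 mA; rewrite -nE => /(_ nA) /(leq_trans le).
  rewrite uE => le' /(_ le') [AE|AE].
    have n20 : 20 <= n by move: n4502; clear; lia.
    by have := card_reds_odd_set_U1 n20 en nA AE; rewrite ltnNge -uE le.
  constructor 4; rewrite -(fsetD1K nA) AE I2E; apply/fsetP => x.
  by rewrite in_fset1U !mem_interval; move: n4502; clear; lia.
have tA : has_top A n.
  split=> // x xA; apply: contraNneq mA; rewrite addnn => <-.
  by rewrite doubleK.
have n2002 : 2002 <= n by move: n4502; clear; lia.
case: (even_step n2002 en tA) => [le'|lt|->]; last by constructor 2.
  have n2E : n.-2 = n./2.-1.*2 by move: en; clear; lia.
  have := @card_reds_weak n./2.-1 (A `&` interval 1 n./2.-1.*2) (fsubsetIr _ _).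
  have : 16 * 2 ^ 2002 < 2 ^ n./2.-1 by apply: error_small; move: n4502; clear; lia.
  have mE : 2 ^ n./2 = 2 * 2 ^ n./2.-1.
    by rewrite -expnS prednK //; move: n4502; clear; lia.
  move: le le'; rewrite uE n2E mE.
  move: (2 ^ n./2.-1) (2 ^ 2002) #|` reds A| #|` reds _| => p x q r.
  by clear; lia.
by move: le; rewrite uE leqNgt lt.
Qed.

(** * The maximum and the sets attaining it *)

Definition extremal (n : nat) (A : {fset nat}) : Prop :=
  A = odd_set n \/ A = I2 n \/
  (~~ odd n /\ (A = interval n./2 n.-1 \/ A = interval n./2 n)).

Lemma card_reds_extremal n A : 1 < n -> extremal n A -> #|` reds A| = 2 ^ uphalf n.
Proof.
move=> n1 [->|[->|[en [->|->]]]].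
- exact: card_reds_odd_set.
- exact: card_reds_I2.
- by rewrite card_reds_interval; [congr (2 ^ _)|]; move: en n1; clear; lia.
- have nE : n = (n./2).*2 by move: en; clear; lia.
  rewrite {2}nE card_reds_sym_interval; last by move: n1; clear; lia.
  by congr (2 ^ _); move: en; clear; lia.
Qed.

Lemma extremal_ge n A : 4502 <= n -> A `<=` interval 1 n ->
  2 ^ uphalf n <= #|` reds A| -> extremal n A.
Proof.
move=> n4502 AN le; case: (boolP (odd n)) => on.
  have n4500 : 4500 <= n by move: n4502; clear; lia.
  by case: (extremal_odd n4500 on AN le) => ->; [left|right; left].
case: (extremal_even n4502 on AN le) => ->; [by left|by right; left|..].
  by right; right; split=> //; left.
by right; right; split=> //; right.
Qed.

Theorem theorem1p1 :
  exists n0 : nat, 0 < n0 /\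
    forall n : nat, n0 <= n ->
      max_num_valid n 2 = 2 ^ uphalf n /\
      forall A : {fset nat}, A `<=` interval 1 n ->
        (num_valid A 2 = max_num_valid n 2 <->
         A = odd_set n \/ A = I2 n \/
         (~~ odd n /\ (A = interval n./2 n.-1 \/ A = interval n./2 n))).
Proof.
(* For even [n] the odd case is used at [n - 1], which must be at least 4500. *)
exists 4502; split=> // n n4502.
have n1 : 1 < n by exact: leq_trans n4502.
have maxE : max_num_valid n 2 = 2 ^ uphalf n.
  apply/eqP; rewrite eqn_leq; apply/andP; split.
    apply/bigmax_leqP_seq => A; rewrite fpowersetE num_validE => AN _.
    (* A set reaching the bound is extremal, and extremal sets attain it exactly. *)
    have [/ltnW//|le] := ltnP #|` reds A| (2 ^ uphalf n).
    by rewrite (card_reds_extremal n1 (extremal_ge n4502 AN le)).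
  rewrite -(card_reds_odd_set n) -num_validE.
  rewrite /max_num_valid; apply: (@leq_bigmax_seq _ _ xpredT (fun A => num_valid A 2)) => //.
  by rewrite fpowersetE; apply/fsubsetP => x; rewrite mem_sep => /andP [].
split=> // A AN; rewrite maxE num_validE; split.
  by move=> E; apply: extremal_ge; rewrite ?E.
exact: card_reds_extremal.
Qed.
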